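(* Let $G$ be a group, $\Gamma$ a quiver, and $\alpha$ a partial action of $G$ on $\Gamma$. Then $(\Gamma,\alpha)$ has an enveloping action $(Q,\beta)$. Moreover, any two enveloping actions of $(\Gamma,\alpha)$ are isomorphic.
   Context: A quiver $\Gamma=(\Gamma_0,\Gamma_1,o,t)$ consists of a set of vertices $\Gamma_0$, a set of arrows $\Gamma_1$, and maps $o,t:\Gamma_1\to\Gamma_0$ giving the source (origin) and target of each arrow. A morphism of quivers $\Psi:\Gamma\to Q$ is a pair of maps $\Psi_0:\Gamma_0\to Q_0$, $\Psi_1:\Gamma_1\to Q_1$ with $o(\Psi_1(x))=\Psi_0(o(x))$ and $t(\Psi_1(x))=\Psi_0(t(x))$ for all $x\in\Gamma_1$. It is an isomorphism if $\Psi_0,\Psi_1$ are bijections, and an inclusion if $\Psi_0,\Psi_1$ are inclusion maps. $\mathrm{Aut}(\Gamma)$ is the group of automorphisms of $\Gamma$. Global action: a global action of $G$ on a quiver $Q$ is a group homomorphism $\beta:G\to\mathrm{Aut}(Q)$, $g\mapsto\beta_g=(\beta_0^g,\beta_1^g)$. It induces global actions $\beta_0$ of $G$ on the set $Q_0$ and $\beta_1$ of $G$ on the set $Q_1$. Partial action on a set: a partial action of $G$ on a set $X$ is a family of subsets $X_g\subseteq X$ and bijections $\alpha_g:X_{g^{-1}}\to X_g$ ($g\in G$) such that $X_e=X$, $\alpha_e=\mathrm{id}_X$; $\alpha_g(X_{g^{-1}}\cap X_h)=X_g\cap X_{gh}$; and $\alpha_g(\alpha_h(x))=\alpha_{gh}(x)$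 for all $x\in\alpha_{h^{-1}}(X_h\cap X_{g^{-1}})$. An enveloping action of it is a global action $\beta$ of $G$ on a set $Y\supseteq X$ such that $X_g=\beta_g(X)\cap X$ and $\alpha_g=\beta_g|_{X_{g^{-1}}}$ for all $g\in G$, and $Y=\bigcup_{g\in G}\beta_g(X)$. Partial action on a quiver: a partial action $\alpha$ of $G$ on $\Gamma$ is a family of subquivers $\Gamma^g=(\Gamma_0^g,\Gamma_1^g)$ of $\Gamma$ ($g\in G$) and quiver isomorphisms $\alpha_g:\Gamma^{g^{-1}}\to\Gamma^g$ such that (i) $\Gamma^e=\Gamma$ and $\alpha_e=\mathrm{id}_\Gamma$; (ii) the vertex parts $(\Gamma_0^g,\alpha_0^g)$ form a partial action $\alpha_0$ of $G$ on the set $\Gamma_0$; (iii) the arrow parts $(\Gamma_1^g,\alpha_1^g)$ form a partial action $\alpha_1$ of $G$ on the set $\Gamma_1$; (iv) $\{t(\gamma):\gamma\in\Gamma_1^g\}\cup\{o(\gamma):\gamma\in\Gamma_1^g\}\subseteq\Gamma_0^g$ for all $g\in G$. Restriction: if $\beta$ is a global action of $G$ on a quiver $Q$ and $\Lambda$ is a subquiver of $Q$, the restriction of $\beta$ to $\Lambda$ is the partial action of $G$ on $\Lambda$ given by $\Lambda_0^g=\beta_g(\Lambda_0)\cap\Lambda_0$, $\Lambda_1^g=\beta_g(\Lambda_1)\cap\Lambda_1$, with $\alpha_g$ the restriction of $\beta_g$ to $\Lambda^{g^{-1}}$. Enveloping action of a partial action on a quiver: a quiver $Q$ with a global action $\beta$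 of $G$ is an enveloping action for $(\Gamma,\alpha)$ if (a) there is an inclusion of quivers $i:\Gamma\hookrightarrow Q$; (b) $(\Gamma,\alpha)$ is the restriction of $(Q,\beta)$; (c) $(Q_0,\beta_0)$ is the enveloping action of $(\Gamma_0,\alpha_0)$; (d) $(Q_1,\beta_1)$ is the enveloping action of $(\Gamma_1,\alpha_1)$. Two enveloping actions $(Q,\beta)$ and $(Q',\beta')$ are isomorphic if there is a quiver isomorphism $\varphi:Q\to Q'$ with $\varphi\circ\beta_g=\beta'_g\circ\varphi$ for all $g\in G$. *)

(* Defs.v *)
From HB Require Import structures.
From mathcomp Require Import all_boot.
From mathcomp Require Import all_classical.

Set Implicit Arguments.
Unset Strict Implicit.
Unset Printing Implicit Defensive.

Local Open Scope classical_set_scope.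

Record quiver := Quiver {
  vertex : Type;
  arrow : Type;
  orig : arrow -> vertex;
  targ : arrow -> vertex
}.

Record quiver_morphism (Q R : quiver) := QuiverMorphism {
  mor0 : vertex Q -> vertex R;
  mor1 : arrow Q -> arrow R;
  mor_orig : forall x, orig (mor1 x) = mor0 (orig x);
  mor_targ : forall x, targ (mor1 x) = mor0 (targ x)
}.

Lemma quiver_morphism_eq (Q R : quiver) (f g : quiver_morphism Q R) :
  mor0 f =1 mor0 g -> mor1 f =1 mor1 g -> f = g.
Proof.
case: f g => [f0 f1 fo ft] [g0 g1 go gt] /= /funext e0 /funext e1.
by subst g0 g1; congr QuiverMorphism; exact: Prop_irrelevance.
Qed.

Definition quiver_id (Q : quiver) : quiver_morphism Q Q :=
  @QuiverMorphism Q Q id id (fun=> erefl) (fun=> erefl).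

Program Definition quiver_comp (Q R S : quiver)
    (f : quiver_morphism R S) (g : quiver_morphism Q R) :
    quiver_morphism Q S :=
  @QuiverMorphism Q S (mor0 f \o mor0 g) (mor1 f \o mor1 g) _ _.
Next Obligation. by move=> Q R S f g x /=; rewrite !mor_orig. Qed.
Next Obligation. by move=> Q R S f g x /=; rewrite !mor_targ. Qed.

Definition is_quiver_iso (Q R : quiver) (f : quiver_morphism Q R) : Prop :=
  bijective (mor0 f) /\ bijective (mor1 f).

Definition is_quiver_inclusion (Q R : quiver) (f : quiver_morphism Q R) : Prop :=
  injective (mor0 f) /\ injective (mor1 f).

Record quiver_aut (Q : quiver) := QuiverAut {
  aut_mor :> quiver_morphism Q Q;
  aut_iso : is_quiver_iso aut_mor
}.

Lemma quiver_aut_eq (Q : quiver) (f g : quiver_aut Q) :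
  mor0 f =1 mor0 g -> mor1 f =1 mor1 g -> f = g.
Proof.
case: f g => [f fi] [g gi] /= e0 e1.
have e := quiver_morphism_eq e0 e1; subst g.
by congr QuiverAut; exact: Prop_irrelevance.
Qed.

Lemma quiver_id_iso (Q : quiver) : is_quiver_iso (quiver_id Q).
Proof. by split; exists id. Qed.

Lemma quiver_comp_iso (Q R S : quiver)
    (f : quiver_morphism R S) (g : quiver_morphism Q R) :
  is_quiver_iso f -> is_quiver_iso g -> is_quiver_iso (quiver_comp f g).
Proof. by move=> [f0 f1] [g0 g1]; split; exact: bij_comp. Qed.

Lemma quiver_iso_inv (Q R : quiver) (f : quiver_morphism Q R) :
  is_quiver_iso f -> exists g : quiver_morphism R Q,
    [/\ is_quiver_iso g, quiver_comp g f = quiver_id Q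
      & quiver_comp f g = quiver_id R].
Proof.
move=> [[g0 fg0 gf0] [g1 fg1 gf1]].
have go x : orig (g1 x) = g0 (orig x).
  by rewrite -[in RHS](gf1 x) mor_orig fg0.
have gt x : targ (g1 x) = g0 (targ x).
  by rewrite -[in RHS](gf1 x) mor_targ fg0.
exists (QuiverMorphism go gt); split; last 2 first.
- exact: quiver_morphism_eq.
- exact: quiver_morphism_eq.
by split; [exists (mor0 f) | exists (mor1 f)].
Qed.

Definition aut_one (Q : quiver) : quiver_aut Q := QuiverAut (quiver_id_iso Q).

Definition aut_mul (Q : quiver) (f g : quiver_aut Q) : quiver_aut Q :=
  QuiverAut (quiver_comp_iso (aut_iso f) (aut_iso g)).

Definition aut_inv (Q : quiver) (f : quiver_aut Q) : quiver_aut Q :=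
  let: exist g gP := cid (quiver_iso_inv (aut_iso f)) in
  let: And3 gi _ _ := gP in QuiverAut gi.

Lemma aut_mulA (Q : quiver) : associative (@aut_mul Q).
Proof. by move=> f g h; exact: quiver_aut_eq. Qed.

Lemma aut_mul1 (Q : quiver) : left_id (aut_one Q) (@aut_mul Q).
Proof. by move=> f; exact: quiver_aut_eq. Qed.

Lemma aut_mulr1 (Q : quiver) : right_id (aut_one Q) (@aut_mul Q).
Proof. by move=> f; exact: quiver_aut_eq. Qed.

Lemma aut_mulV (Q : quiver) : left_inverse (aut_one Q) (@aut_inv Q) (@aut_mul Q).
Proof.
move=> f; rewrite /aut_inv; case: cid => g [gi gf fg].
by apply: quiver_aut_eq => x /=;
  [rewrite -[RHS]/(mor0 (quiver_id Q) x) | rewrite -[RHS]/(mor1 (quiver_id Q) x)];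
  rewrite -gf.
Qed.

Lemma aut_mulrV (Q : quiver) : right_inverse (aut_one Q) (@aut_inv Q) (@aut_mul Q).
Proof.
move=> f; rewrite /aut_inv; case: cid => g [gi gf fg].
by apply: quiver_aut_eq => x /=;
  [rewrite -[RHS]/(mor0 (quiver_id Q) x) | rewrite -[RHS]/(mor1 (quiver_id Q) x)];
  rewrite -fg.
Qed.

HB.instance Definition _ (Q : quiver) := gen_eqMixin (quiver_aut Q).
HB.instance Definition _ (Q : quiver) := gen_choiceMixin (quiver_aut Q).
HB.instance Definition _ (Q : quiver) :=
  isGroup.Build (quiver_aut Q) (@aut_mulA Q) (@aut_mul1 Q) (@aut_mulr1 Q)
    (@aut_mulV Q) (@aut_mulrV Q).

(* The product of Aut(Q) is composition, so this is a left action. *)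
Notation quiver_action G Q := (UMagmaMorphism.type G (quiver_aut Q)).

Record set_action (G : groupType) (Y : Type) := SetAction {
  act :> G -> Y -> Y;
  act1 : forall y, act 1%g y = y;
  actM : forall g h y, act (g * h)%g y = act g (act h y)
}.

Program Definition vertex_action (G : groupType) (Q : quiver)
    (b : quiver_action G Q) : set_action G (vertex Q) :=
  @SetAction G (vertex Q) (fun g => mor0 (b g)) _ _.
Next Obligation. by move=> G Q b v /=; rewrite gmulf1. Qed.
Next Obligation. by move=> G Q b g h v /=; rewrite gmulfM. Qed.

Program Definition arrow_action (G : groupType) (Q : quiver)
    (b : quiver_action G Q) : set_action G (arrow Q) :=
  @SetAction G (arrow Q) (fun g => mor1 (b g)) _ _.
Next Obligation. by move=> G Q b x /=; rewrite gmulf1. Qed.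
Next Obligation. by move=> G Q b g h x /=; rewrite gmulfM. Qed.

(* A partial bijection X_{g^-1} -> X_g is encoded by a total function a g,
   which is only meaningful on D g^-1: its values elsewhere are arbitrary, and
   no notion below depends on them. *)
Record is_set_partial_action (G : groupType) (X : Type)
    (D : G -> set X) (a : G -> X -> X) : Prop := IsSetPartialAction {
  spa_bij : forall g, set_bij (D g^-1%g) (D g) (a g);
  spa_dom1 : D 1%g = [set: X];
  spa_map1 : forall x, a 1%g x = x;
  spa_domM : forall g h,
    a g @` (D g^-1%g `&` D h) = D g `&` D (g * h)%g;
  spa_mapM : forall g h x, (a h^-1%g @` (D h `&` D g^-1%g)) x ->
    a g (a h x) = a (g * h)%g x
}.

(* The containment of X in Y is rendered by an injection i : X -> Y. *)
Record is_set_enveloping (G : groupType) (X Y : Type)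
    (D : G -> set X) (a : G -> X -> X) (b : set_action G Y) (i : X -> Y) :
    Prop := IsSetEnveloping {
  senv_inj : injective i;
  senv_dom : forall g, i @` D g = (b g @` range i) `&` range i;
  senv_map : forall g x, D g^-1%g x -> i (a g x) = b g (i x);
  senv_cover : [set: Y] = \bigcup_(g in [set: G]) (b g @` range i)
}.

Record subquiver (Q : quiver) := Subquiver {
  sub0 : set (vertex Q);
  sub1 : set (arrow Q);
  sub_orig : forall x, sub1 x -> sub0 (orig x);
  sub_targ : forall x, sub1 x -> sub0 (targ x)
}.

Lemma subquiver_eq (Q : quiver) (L M : subquiver Q) :
  sub0 L = sub0 M -> sub1 L = sub1 M -> L = M.
Proof.
case: L M => [L0 L1 Lo Lt] [M0 M1 Mo Mt] /= e0 e1.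
by subst M0 M1; congr Subquiver; exact: Prop_irrelevance.
Qed.

Definition subquiver_full (Q : quiver) : subquiver Q :=
  @Subquiver Q setT setT (fun _ _ => I) (fun _ _ => I).

Program Definition subquiverI (Q : quiver) (L M : subquiver Q) : subquiver Q :=
  @Subquiver Q (sub0 L `&` sub0 M) (sub1 L `&` sub1 M) _ _.
Next Obligation.
by move=> Q L M x [Lx Mx]; split; exact: sub_orig.
Qed.
Next Obligation.
by move=> Q L M x [Lx Mx]; split; exact: sub_targ.
Qed.

Program Definition subquiver_image (Q R : quiver) (f : quiver_morphism Q R)
    (L : subquiver Q) : subquiver R :=
  @Subquiver R (mor0 f @` sub0 L) (mor1 f @` sub1 L) _ _.
Next Obligation.
move=> Q R f L _ [x Lx <-] /=; exists (orig x); first exact: sub_orig.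
by rewrite mor_orig.
Qed.
Next Obligation.
move=> Q R f L _ [x Lx <-] /=; exists (targ x); first exact: sub_targ.
by rewrite mor_targ.
Qed.

(* As for partial actions on sets, only the values of f0 and f1 on L matter. *)
Record is_subquiver_iso (Q : quiver) (L M : subquiver Q)
    (f0 : vertex Q -> vertex Q) (f1 : arrow Q -> arrow Q) : Prop :=
    IsSubquiverIso {
  subiso_bij0 : set_bij (sub0 L) (sub0 M) f0;
  subiso_bij1 : set_bij (sub1 L) (sub1 M) f1;
  subiso_orig : forall x, sub1 L x -> orig (f1 x) = f0 (orig x);
  subiso_targ : forall x, sub1 L x -> targ (f1 x) = f0 (targ x)
}.

Record quiver_partial_action (G : groupType) (Gamma : quiver) :=
    QuiverPartialAction {
  pdom : G -> subquiver Gamma;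
  pmap0 : G -> vertex Gamma -> vertex Gamma;
  pmap1 : G -> arrow Gamma -> arrow Gamma;
  pmap_iso : forall g,
    is_subquiver_iso (pdom g^-1%g) (pdom g) (pmap0 g) (pmap1 g);
  pdom_one : pdom 1%g = subquiver_full Gamma;
  pmap0_one : forall v, pmap0 1%g v = v;
  pmap1_one : forall x, pmap1 1%g x = x;
  pmap_vertex : is_set_partial_action (fun g => sub0 (pdom g)) pmap0;
  pmap_arrow : is_set_partial_action (fun g => sub1 (pdom g)) pmap1;
  pdom_ends : forall g,
    (@targ Gamma @` sub1 (pdom g)) `|` (@orig Gamma @` sub1 (pdom g))
      `<=` sub0 (pdom g)
}.

Definition restriction_dom (G : groupType) (Q : quiver)
    (b : quiver_action G Q) (L : subquiver Q) (g : G) : subquiver Q :=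
  subquiverI (subquiver_image (b g) L) L.

(* Transported along i, the partial action alpha is the restriction of b to
   the subquiver i(Gamma). *)
Record is_restriction (G : groupType) (Gamma Q : quiver)
    (alpha : quiver_partial_action G Gamma) (b : quiver_action G Q)
    (i : quiver_morphism Gamma Q) : Prop := IsRestriction {
  restr_dom : forall g, subquiver_image i (pdom alpha g) =
    restriction_dom b (subquiver_image i (subquiver_full Gamma)) g;
  restr_map0 : forall g v, sub0 (pdom alpha g^-1%g) v ->
    mor0 i (pmap0 alpha g v) = mor0 (b g) (mor0 i v);
  restr_map1 : forall g x, sub1 (pdom alpha g^-1%g) x ->
    mor1 i (pmap1 alpha g x) = mor1 (b g) (mor1 i x)
}.

Definition is_enveloping (G : groupType) (Gamma : quiver)
    (alpha : quiver_partial_action G Gamma) (Q : quiver)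
    (b : quiver_action G Q) : Prop :=
  exists i : quiver_morphism Gamma Q,
    [/\ is_quiver_inclusion i,
        is_restriction alpha b i,
        is_set_enveloping (fun g => sub0 (pdom alpha g)) (pmap0 alpha)
          (vertex_action b) (mor0 i)
      & is_set_enveloping (fun g => sub1 (pdom alpha g)) (pmap1 alpha)
          (arrow_action b) (mor1 i)].

Definition quiver_actions_isomorphic (G : groupType) (Q R : quiver)
    (b : quiver_action G Q) (c : quiver_action G R) : Prop :=
  exists2 phi : quiver_morphism Q R, is_quiver_iso phi &
    forall g, quiver_comp phi (b g) = quiver_comp (c g) phi.

(* Main.v *)
(* On sets, the enveloping action is the quotient of G * X by the relation
   identifying (g, x) with (h, y) when the partial action moves x to y by
   h^-1 g.  In any enveloping action Y, g x = h y holds exactly under this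
   condition, which refers to the partial action only; since every element of Y
   is some g x, a map X -> X' compatible with two partial actions extends
   uniquely to an equivariant map Y -> Y'.  Extending the origin and target maps
   of Gamma yields the quiver structure on the enveloping actions of its
   vertices and arrows, and extending the identity yields the isomorphism
   between two enveloping actions. *)

Require Import Defs.
From HB Require Import structures.
From mathcomp Require Import all_boot.
From mathcomp Require Import all_classical.

Set Implicit Arguments.
Unset Strict Implicit.
Unset Printing Implicit Defensive.

Local Open Scope classical_set_scope.
Local Open Scope group_scope.

Lemma surj_factor (A Y Z : Type) (p : A -> Y) (q : A -> Z) :
  (forall y, exists a, p a = y) ->
  (forall a b, p a = p b -> q a = q b) ->
  exists f : Y -> Z, forall a, f (p a) = q a.
Proof.
move=> psurj pq; exists (fun y => q (sval (cid (psurj y)))) => a.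
by case: cid => b /= /pq.
Qed.

(** Equivalence classes are taken as the predicates [R a]; extensionality makes the classes of
    related elements equal. *)
Lemma quotient_exists (A : Type) (R : A -> A -> Prop) :
  (forall a, R a a) -> (forall a b, R a b -> R b a) ->
  (forall a b c, R a b -> R b c -> R a c) ->
  exists (Y : Type) (p : A -> Y),
    (forall y, exists a, p a = y) /\ (forall a b, p a = p b <-> R a b).
Proof.
move=> Rrefl Rsym Rtrans.
exists {s : A -> Prop | exists a, s = R a}.
exists (fun a => exist _ (R a) (ex_intro _ a erefl)); split.
  by move=> [s [a sa]]; exists a; subst s.
move=> a b; split=> [/(congr1 sval)/= ab|ab].
  by rewrite ab; exact: Rrefl.
apply: eq_exist => /=; apply/funext => c; apply/propext; split=> [ac|].
  exact: Rtrans (Rsym _ _ ab) ac.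
exact: Rtrans.
Qed.

Lemma actK (G : groupType) (Y : Type) (b : set_action G Y) g y :
  b g^-1 (b g y) = y.
Proof. by rewrite -actM mulVg act1. Qed.

Lemma actVK (G : groupType) (Y : Type) (b : set_action G Y) g y :
  b g (b g^-1 y) = y.
Proof. by rewrite -actM mulgV act1. Qed.

Lemma set_action_eq (G : groupType) (Y : Type) (b c : set_action G Y) :
  (forall g y, b g y = c g y) -> b = c.
Proof.
case: b c => [b b1 bM] [c c1 cM] /= bc.
have e : b = c by apply/funext => g; apply/funext.
by subst c; congr SetAction; exact: Prop_irrelevance.
Qed.

Lemma spa_sub (G : groupType) (X : Type) (D : G -> set X) (a : G -> X -> X) :
  is_set_partial_action D a -> forall g x, D g^-1 x -> D g (a g x).
Proof. by move=> pa g x Dx; have [+ _ _] := spa_bij pa g; exact. Qed.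

Lemma spa_mapK (G : groupType) (X : Type) (D : G -> set X) (a : G -> X -> X) :
  is_set_partial_action D a ->
  forall g x, D g^-1 x -> a g^-1 (a g x) = x.
Proof.
move=> pa g x Dx; rewrite (spa_mapM pa) ?mulVg ?(spa_map1 pa)//.
(* The composition law for [g^-1] and [g] needs [x] in the image of [a g^-1]; this is the
   surjectivity of that bijection. *)
have [_ _ /(_ x Dx)[z]] := spa_bij pa g^-1; rewrite invgK => Dz zx.
by exists z => //; split; rewrite ?invgK.
Qed.

(** Since [x] is the image under [a h^-1] of [a h x], a point of [D h] and [D g^-1], both the domain
    law and the composition law apply to it. *)
Lemma spa_map_comp (G : groupType) (X : Type) (D : G -> set X)
    (a : G -> X -> X) : is_set_partial_action D a ->
  forall g h x, D h^-1 x -> D g^-1 (a h x) ->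
    D (g * h)^-1 x /\ a g (a h x) = a (g * h) x.
Proof.
move=> pa g h x Dx Dhx; have Dh := spa_sub pa Dx.
have im : (a h^-1 @` (D h `&` D g^-1)) x.
  by exists (a h x); [split | exact: (spa_mapK pa)].
split; last exact: (spa_mapM pa).
have := spa_domM pa h^-1 g^-1; rewrite invgK -invgM => dom.
by move: im; rewrite dom => -[].
Qed.

(* The relation g x = h y, as seen from the partial action. *)
Definition envelope_rel (G : groupType) (X : Type) (D : G -> set X)
    (a : G -> X -> X) (p q : G * X) : Prop :=
  D (p.1^-1 * q.1) p.2 /\ a (q.1^-1 * p.1) p.2 = q.2.

Lemma envelope_rel_refl (G : groupType) (X : Type) (D : G -> set X)
    (a : G -> X -> X) : is_set_partial_action D a ->
  forall p, envelope_rel D a p p.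
Proof.
move=> pa [g x]; rewrite /envelope_rel/= mulVg (spa_dom1 pa).
by rewrite (spa_map1 pa).
Qed.

Lemma envelope_rel_sym (G : groupType) (X : Type) (D : G -> set X)
    (a : G -> X -> X) : is_set_partial_action D a ->
  forall p q, envelope_rel D a p q -> envelope_rel D a q p.
Proof.
move=> pa [g x] [h y]; rewrite /envelope_rel/= => -[Dx <-].
have Vgh : (h^-1 * g)^-1 = g^-1 * h by rewrite invgM invgK.
rewrite -Vgh in Dx *.
by split; [exact: (spa_sub pa) | exact: (spa_mapK pa)].
Qed.

(** The moves by [h^-1 * g] and then [k^-1 * h] compose to the move by [k^-1 * g]. *)
Lemma envelope_rel_trans (G : groupType) (X : Type) (D : G -> set X)
    (a : G -> X -> X) : is_set_partial_action D a ->
  forall p q r, envelope_rel D a p q -> envelope_rel D a q r ->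
  envelope_rel D a p r.
Proof.
move=> pa [g x] [h y] [k z]; rewrite /envelope_rel/= => -[Dx <-] [Dy <-].
have V u v : u^-1 * v = (v^-1 * u)^-1 :> G by rewrite invgM invgK.
rewrite (V g) in Dx; rewrite (V h) in Dy.
have [] := spa_map_comp pa Dx Dy.
by rewrite -mulgA mulVKg -V => ? ->.
Qed.

Lemma senv_rel (G : groupType) (X Y : Type) (D : G -> set X)
    (a : G -> X -> X) (b : set_action G Y) (i : X -> Y) :
  is_set_enveloping D a b i ->
  forall g h x y, b g (i x) = b h (i y) <-> envelope_rel D a (g, x) (h, y).
Proof.
move=> env g h x y; rewrite /envelope_rel/=.
have V : g^-1 * h = (h^-1 * g)^-1 by rewrite invgM invgK.
split=> [gxhy|[Dx <-]]; last first.
  by rewrite V in Dx; rewrite (senv_map env Dx) actM actVK.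
(* The point [i x] is the translate of [i y] by [g^-1 * h], so it lies in the range of [i] and in
   its translate. *)
have Dx : D (g^-1 * h) x.
  have : (i @` D (g^-1 * h)) (i x).
    rewrite (senv_dom env); split; last by exists x.
    by exists (i y); [exists y | rewrite actM -gxhy actK].
  by move=> [z Dz /(senv_inj env) <-].
split=> //; apply: (senv_inj env).
by rewrite (senv_map env) -?V// actM gxhy actK.
Qed.

Lemma senv_coverP (G : groupType) (X Y : Type) (D : G -> set X)
    (a : G -> X -> X) (b : set_action G Y) (i : X -> Y) :
  is_set_enveloping D a b i ->
  forall y, exists p : G * X, b p.1 (i p.2) = y.
Proof.
move=> env y; have : [set: Y] y by [].
by rewrite (senv_cover env) => -[g _ [_ [x _ <-] <-]]; exists (g, x).
Qed.

Lemma senv_exists (G : groupType) (X : Type) (D : G -> set X)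
    (a : G -> X -> X) : is_set_partial_action D a ->
  exists (Y : Type) (b : set_action G Y) (i : X -> Y),
    is_set_enveloping D a b i.
Proof.
move=> pa.
have [Y [p [psurj pE]]] := quotient_exists (envelope_rel_refl pa)
  (envelope_rel_sym pa) (envelope_rel_trans pa).
(* Left translation of the first coordinate descends to [Y], because the relation sees first
   coordinates only through [g^-1 * h] and [h^-1 * g]. *)
have /choice[b bE] : forall g, exists f : Y -> Y,
    forall q, f (p q) = p (g * q.1, q.2).
  move=> g; apply: surj_factor => // -[h x] [k y] /pE hxky.
  by apply/pE; move: hxky; rewrite /envelope_rel/= !invgM -!mulgA !mulKg.
have b1 y : b 1 y = y.
  by have [[g x] <-] := psurj y; rewrite bE mul1g.
have bM g h y : b (g * h) y = b g (b h y).
  by have [[k x] <-] := psurj y; rewrite !bE /= mulgA.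
exists Y, (SetAction b1 bM), (fun x => p (1, x)).
(* With [X] embedded as the classes of [(1, x)], this says that the global action extends the
   partial one. *)
have VD g x : D g^-1 x -> p (g, x) = p (1, a g x).
  by move=> Dx; apply/pE; rewrite /envelope_rel/= invg1 mulg1 mul1g.
split=> /=.
- by move=> x y /pE[_ /=]; rewrite mulVg (spa_map1 pa).
- move=> g; apply/seteqP; split=> [_ [y Dy <-]|_ [[_ [x _ <-] <-] [y _]]].
    split; last by exists y.
    have [_ _ /(_ y Dy)[x Dx <-]] := spa_bij pa g.
    exists (p (1, x)); first by exists x.
    by rewrite bE /= mulg1 VD.
  rewrite bE /= mulg1 => yx; exists y => //.
  move/esym/pE: yx; rewrite /envelope_rel/= invg1 mulg1 mul1g => -[Dx <-].
  exact: (spa_sub pa).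
- by move=> g x Dx; rewrite bE /= mulg1 (VD _ _ Dx).
- apply/seteqP; split=> // y _; have [[g x] <-] := psurj y.
  exists g => //; exists (p (1, x)); first by exists x.
  by rewrite bE /= mulg1.
Qed.

(** The value at [b g (i x)] has to be [b' g (i' (f x))]. This is well defined because [f] preserves
    [envelope_rel], which describes equality of translates in both [Y] and [Y']. *)
Lemma senv_extend (G : groupType) (X X' Y Y' : Type)
    (D : G -> set X) (a : G -> X -> X) (b : set_action G Y) (i : X -> Y)
    (D' : G -> set X') (a' : G -> X' -> X') (b' : set_action G Y')
    (i' : X' -> Y') (f : X -> X') :
  is_set_enveloping D a b i -> is_set_enveloping D' a' b' i' ->
  (forall g x, D g x -> D' g (f x)) ->
  (forall g x, D g^-1 x -> f (a g x) = a' g (f x)) ->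
  exists F : Y -> Y', (forall x, F (i x) = i' (f x)) /\
    (forall g y, F (b g y) = b' g (F y)).
Proof.
move=> env env' fD fa.
have [|F FE] := surj_factor (q := fun p => b' p.1 (i' (f p.2)))
    (senv_coverP env).
  move=> [g x] [h y] /= /(senv_rel env)[/= Dx <-]; apply/(senv_rel env').
  split=> /=; first exact: fD.
  by rewrite fa// invgM invgK.
have FgE g x : F (b g (i x)) = b' g (i' (f x)) := FE (g, x).
exists F; split=> [x|g y]; first by rewrite -(act1 b (i x)) FgE act1.
by have [[h x] <-] := senv_coverP env y; rewrite -actM !FgE actM.
Qed.

(** The translates of [i x] exhaust [Y], so an equivariant map is determined on the range of [i]. *)
Lemma senv_ext (G : groupType) (X Y Z : Type) (D : G -> set X)
    (a : G -> X -> X) (b : set_action G Y) (i : X -> Y) (c : set_action G Z)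
    (F F' : Y -> Z) :
  is_set_enveloping D a b i ->
  (forall g y, F (b g y) = c g (F y)) ->
  (forall g y, F' (b g y) = c g (F' y)) ->
  (forall x, F (i x) = F' (i x)) -> F =1 F'.
Proof.
move=> env Fb Fb' FF y; have [[g x] <-] := senv_coverP env y.
by rewrite Fb Fb' FF.
Qed.

Lemma senv_unique (G : groupType) (X Y Z : Type) (D : G -> set X)
    (a : G -> X -> X) (b : set_action G Y) (i : X -> Y) (c : set_action G Z)
    (j : X -> Z) :
  is_set_enveloping D a b i -> is_set_enveloping D a c j ->
  exists F : Y -> Z, [/\ bijective F, forall x, F (i x) = j x &
    forall g y, F (b g y) = c g (F y)].
Proof.
move=> envb envc.
have [//|//|F [Fi Fb]] := @senv_extend _ _ _ _ _ _ _ _ _ _ _ _ _ id envb envc.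
have [//|//|F' [Fj Fc]] := @senv_extend _ _ _ _ _ _ _ _ _ _ _ _ _ id envc envb.
exists F; split=> //; exists F'.
(* Each composite is equivariant and fixes the copy of [X], hence is the identity. *)
- apply: (@senv_ext _ _ _ _ _ _ _ _ b (F' \o F) id envb) => //= [g y|x].
    by rewrite Fb Fc.
  by rewrite Fi Fj.
- apply: (@senv_ext _ _ _ _ _ _ _ _ c (F \o F') id envc) => //= [g y|x].
    by rewrite Fc Fb.
  by rewrite Fj Fi.
Qed.

(** Equivariance of the end maps makes each [g] act by a quiver morphism, inverted by the action of
    [g^-1]. *)
Lemma quiver_action_of_set_actions (G : groupType) (Q : quiver)
    (b0 : set_action G (vertex Q)) (b1 : set_action G (arrow Q)) :
  (forall g x, orig (b1 g x) = b0 g (orig x)) ->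
  (forall g x, targ (b1 g x) = b0 g (targ x)) ->
  exists b : quiver_action G Q, vertex_action b = b0 /\ arrow_action b = b1.
Proof.
move=> bo bt.
pose m g := QuiverMorphism (bo g) (bt g).
have m_iso g : is_quiver_iso (m g).
  by split; [exists (b0 g^-1) | exists (b1 g^-1)] => y /=;
    rewrite (actK, actVK).
pose b g := QuiverAut (m_iso g).
have b1E : b 1 = 1.
  by apply: quiver_aut_eq => y /=; rewrite act1.
have bM : {morph b : g h / g * h}.
  by move=> g h; apply: quiver_aut_eq => y /=; rewrite actM.
pose bmul := isMultiplicative.Build _ _ b bM.
pose bone := Multiplicative_isUMagmaMorphism.Build _ _ b b1E.
exists (UMagmaMorphism.Pack (UMagmaMorphism.Class bone bmul)).
by split; exact: set_action_eq.
Qed.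

Theorem theorem2p8 (G : groupType) (Gamma : quiver)
    (alpha : quiver_partial_action G Gamma) :
  (exists (Q : quiver) (b : quiver_action G Q), is_enveloping alpha b) /\
  (forall (Q R : quiver) (b : quiver_action G Q) (c : quiver_action G R),
     is_enveloping alpha b -> is_enveloping alpha c ->
     quiver_actions_isomorphic b c).
Proof.
split.
  have [Y0 [b0 [i0 env0]]] := senv_exists (pmap_vertex alpha).
  have [Y1 [b1 [i1 env1]]] := senv_exists (pmap_arrow alpha).
  (* [oi] will make the inclusion a quiver morphism, and [ob] will make the action one by quiver
     morphisms. *)
  have [||o [oi ob]] := senv_extend (f := @orig Gamma) env1 env0.
  - by move=> g x; exact: sub_orig.
  - by move=> g x; exact: (subiso_orig (pmap_iso alpha g)).
  have [||t [ti tb]] := senv_extend (f := @targ Gamma) env1 env0.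
  - by move=> g x; exact: sub_targ.
  - by move=> g x; exact: (subiso_targ (pmap_iso alpha g)).
  pose Q := Quiver o t.
  have [b [vb ab]] := @quiver_action_of_set_actions G Q b0 b1 ob tb.
  exists Q, b; pose i := @QuiverMorphism Gamma Q i0 i1 oi ti; exists i.
  rewrite -vb in env0; rewrite -ab in env1.
  split=> //.
  - by split; [exact: senv_inj env0 | exact: senv_inj env1].
  - split=> [g||]; [|exact: senv_map env0|exact: senv_map env1].
    by apply: subquiver_eq; [exact: (senv_dom env0 g) | exact: (senv_dom env1 g)].
move=> Q R b c [i [_ _ envb0 envb1]] [j [_ _ envc0 envc1]].
have [F0 [bij0 F0i F0b]] := senv_unique envb0 envc0.
have [F1 [bij1 F1i F1b]] := senv_unique envb1 envc1.
(* Both sides are equivariant from arrows of [Q] to vertices of [R] and agree on the arrows of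
   [Gamma]. *)
have Fo x : orig (F1 x) = F0 (orig x).
  apply: (senv_ext (c := vertex_action c) (F := fun x => orig (F1 x))
    (F' := fun x => F0 (orig x)) envb1) => [g y|g y|y].
  - by rewrite F1b /= mor_orig.
  - by rewrite -[RHS]F0b /= mor_orig.
  - by rewrite F1i !mor_orig F0i.
have Ft x : targ (F1 x) = F0 (targ x).
  apply: (senv_ext (c := vertex_action c) (F := fun x => targ (F1 x))
    (F' := fun x => F0 (targ x)) envb1) => [g y|g y|y].
  - by rewrite F1b /= mor_targ.
  - by rewrite -[RHS]F0b /= mor_targ.
  - by rewrite F1i !mor_targ F0i.
exists (QuiverMorphism Fo Ft); first by split.
by move=> g; apply: quiver_morphism_eq => y /=; [exact: F0b | exact: F1b].
Qed.
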